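(* Let $p\in\mathbb{N}_0$ and $t>0$, and let $A,v,\beta,V_m,H_m,h_{m+1,m},v_{m+1},U_m$ be as in the context (a perturbed Arnoldi decomposition $AV_m=V_mH_m+h_{m+1,m}v_{m+1}e_m^*+U_m$ with $\beta V_me_1=v$). Let $y_{p,m}(t)=\beta\varphi_p(tH_m)e_1\in\mathbb{C}^m$, $\delta_{p,m}(t)=\beta\, e_m^* t^p\varphi_p(tH_m)e_1\in\mathbb{C}$, and let $l_{p,m}(t)=\beta V_m\varphi_p(tH_m)e_1-\varphi_p(tA)v$ be the error of the Krylov propagator. Then: (a) The error has the integral representation $$l_{p,m}(t) = -\frac{h_{m+1,m}}{t^p}\int_0^t e^{(t-s)A}v_{m+1}\,\delta_{p,m}(s)\,ds-\frac{1}{t^p}\int_0^t e^{(t-s)A}U_m\, s^p\, y_{p,m}(s)\,ds .$$ (b) Let $\varepsilon>0$ be the machine precision and let $C_1,C_2\ge 0$ be constants with $\|U_m\|_2\le C_1\varepsilon\|A\|_2$ and $\big|\|v_{m+1}\|_2-1\big|\le C_2\varepsilon$. With $\kappa_1=\max_{s\in[0,t]}\|e^{sA}\|_2$ and $\kappa_2=\max_{s\in[0,t]}\|e^{sH_m}\|_2$, the error norm is bounded by $$\|l_{p,m}(t)\|_2\le (1+C_2\varepsilon)\,\kappa_1\, L_{p,m}(t)+C_1\varepsilon\|A\|_2\,\frac{\beta\kappa_1\kappa_2 t}{(p+1)!},$$ where $L_{p,m}(t)=\dfrac{h_{m+1,m}}{t^p}\displaystyle\int_0^t|\delta_{p,m}(s)|\,ds$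 is the defect integral.
   Context: For $p\in\mathbb{N}_0$, $\varphi_p(z)=\sum_{k=0}^\infty \frac{z^k}{(k+p)!}$ (an entire function, $\varphi_0=\exp$), and $\varphi_p$ of a square matrix is defined by the same power series. $e_j$ denotes the $j$-th unit vector (of $\mathbb{C}^m$ or $\mathbb{C}^n$), $^*$ the conjugate transpose, $\|\cdot\|_2$ the Euclidean norm or spectral norm. Setting: $A\in\mathbb{C}^{n\times n}$, $0\neq v\in\mathbb{C}^n$, $\beta=\|v\|_2$. The matrices $V_m\in\mathbb{C}^{n\times m}$, $H_m\in\mathbb{C}^{m\times m}$, the number $h_{m+1,m}>0$, the vector $v_{m+1}\in\mathbb{C}^n$ and the perturbation $U_m\in\mathbb{C}^{n\times m}$ are the result of the Arnoldi method (in floating point arithmetic) for the Krylov subspace $\mathrm{span}(v,Av,\dots,A^{m-1}v)$: $H_m$ is upper Hessenberg with real positive lower subdiagonal entries, $\beta V_me_1=v$, and $$AV_m=V_mH_m+h_{m+1,m}v_{m+1}e_m^*+U_m,$$ where $U_m$ collects round-off errors. Orthonormality of the columns of $V_m$ is not assumed. *)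

(* Defs.v *)
(* The complex numbers are R[i] over an abstract R : realType. *)
From HB Require Import structures.
From mathcomp Require Export all_boot all_order all_algebra.
From mathcomp Require Export all_classical all_reals all_analysis.
From mathcomp Require Export complex.
Set Implicit Arguments.
Unset Strict Implicit.
Unset Printing Implicit Defensive.
Export Order.TTheory GRing.Theory Num.Theory.
Export numFieldNormedType.Exports.
Local Open Scope classical_set_scope.
Local Open Scope complex_scope.
Local Open Scope sesquilinear_scope.
Local Open Scope ring_scope.

(* R[i] does not inherit the topology of an abstract numFieldType by
   unification; this instance also provides the topology of 'M[R[i]]_n. *)
HB.instance Definition _ (R : realType) := NormedModule.copy R[i] R[i]^o.

Definition expmx (R : realType) (n : nat) (A : 'M[R[i]]_n) : 'M[R[i]]_n :=
  lim (series (fun k => (k`!%:R)^-1 *: A ^+ k) @ \oo).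

Definition phimx (R : realType) (p n : nat) (A : 'M[R[i]]_n) : 'M[R[i]]_n :=
  lim (series (fun k => ((k + p)`!%:R)^-1 *: A ^+ k) @ \oo).

Definition unitv (R : realType) (n : nat) (j : 'I_n) : 'cV[R[i]]_n :=
  delta_mx j 0.

(* The library norm `|_| on matrices is the maximum norm with values in R[i];
   the norms below are real valued. *)
Definition norm2 (R : realType) (n : nat) (x : 'cV[R[i]]_n) : R :=
  Num.sqrt (\sum_(i < n) Normc.normc (x i 0) ^+ 2).

Definition specnorm (R : realType) (m n : nat) (M : 'M[R[i]]_(m, n)) : R :=
  sup [set norm2 (M *m x) | x in [set x : 'cV[R[i]]_n | norm2 x <= 1]].

(* The value is 0 if f does not attain a maximum on D. *)
Definition max_on (R : realType) (D : set R) (f : R -> R) : R :=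
  xget 0 [set y | (f @` D) y /\ ubound (f @` D) y].

Definition cintegral (R : realType) (a b : R) (f : R -> R[i]) : R[i] :=
  (\int[lebesgue_measure]_(s in `[a, b]) complex.Re (f s)) +i*
  (\int[lebesgue_measure]_(s in `[a, b]) complex.Im (f s)).

Definition vintegral (R : realType) (n : nat) (a b : R)
    (f : R -> 'cV[R[i]]_n) : 'cV[R[i]]_n :=
  \col_(i < n) cintegral a b (fun s => f s i 0).

(* In the following definitions the Krylov dimension is m.+1, so that e_1 is
   unitv ord0 and e_m is unitv ord_max; beta is the Euclidean norm of v. *)
Definition krylov_y (R : realType) (p m : nat) (beta : R)
    (H : 'M[R[i]]_m.+1) (t : R) : 'cV[R[i]]_m.+1 :=
  beta%:C *: (phimx p (t%:C *: H) *m unitv R ord0).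

Definition krylov_defect (R : realType) (p m : nat) (beta : R)
    (H : 'M[R[i]]_m.+1) (t : R) : R[i] :=
  beta%:C *
  ((unitv R ord_max)^t* *m ((t ^+ p)%:C *: phimx p (t%:C *: H))
     *m unitv R ord0) 0 0.

Definition krylov_error (R : realType) (p n m : nat) (A : 'M[R[i]]_n)
    (v : 'cV[R[i]]_n) (V : 'M[R[i]]_(n, m.+1)) (H : 'M[R[i]]_m.+1)
    (t : R) : 'cV[R[i]]_n :=
  (norm2 v)%:C *: (V *m phimx p (t%:C *: H) *m unitv R ord0)
  - phimx p (t%:C *: A) *m v.

Definition defect_integral (R : realType) (p m : nat) (beta h : R)
    (H : 'M[R[i]]_m.+1) (t : R) : R :=
  h / t ^+ p *
  \int[lebesgue_measure]_(s in `[0, t]) Normc.normc (krylov_defect p beta H s).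

(* Main.v *)
Require Import Defs.
From mathcomp Require Import ring lra.
Set Implicit Arguments.
Unset Strict Implicit.
Unset Printing Implicit Defensive.
Local Open Scope classical_set_scope.
Local Open Scope complex_scope.
Local Open Scope sesquilinear_scope.
Local Open Scope ring_scope.

(* Put G(s) = - s^p l_p(s) = s^p phi_p(sA) v - V (s^p y_p(s)).  The coefficients
   of G with respect to s^k/k! are g_k = A^(k-p) v - beta V H^(k-p) e_1 for
   k >= p, and 0 for k < p, so that g_0 = 0, and the Arnoldi relation gives
   g_(k+1) = A g_k + h r_k + u_k, where r_k and u_k are the coefficients of
   delta(s) w and U s^p y_p(s); in other words
   G' = A G + h delta w + U s^p y_p and G(0) = 0.  Part (a) is the fundamental
   theorem of calculus for s |-> e^((t-s)A) G(s) on [0,t].  Part (b) bounds the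
   derivative of the same function in norm, where
   ||s^p phi_p(sH) e_1|| <= kappa_2 s^p / p! follows by induction on p, since the
   derivative of s^(p+1) phi_(p+1)(sH) is s^p phi_p(sH). *)

(** * Real power series normalised by 1/k! *)

Section RealExponentialSeries.
Variable R : realType.
Implicit Types (c d : nat -> R) (x y a : R).

(** Geometric growth of the coefficients makes the terms c_k x^k / k! dominated by those of C exp(M
    |x|), so the series converges for every x. The requirement 1 <= M makes M^k nondecreasing in k,
    so that a delay of the coefficients keeps the same bound. *)
Definition expbnd c :=
  exists C M : R, [/\ 0 <= C, 1 <= M & forall k, `|c k| <= C * M ^+ k].

(* With the factor 1/k! built in, differentiation is a shift of the
   coefficients. *)
Definition expser c x : R := limn (pseries (fun k => k`!%:R^-1 * c k) x).

Lemma expbndD c d : expbnd c -> expbnd d -> expbnd (fun k => c k + d k).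
Proof.
move=> [C [M [C0 M1 cM]]] [D [N [D0 N1 dN]]].
have M0 : 0 <= M := le_trans ler01 M1.
have N0 : 0 <= N := le_trans ler01 N1.
exists (C + D), (Num.max M N); split; first exact: addr_ge0.
  by rewrite le_max M1.
move=> k; rewrite (le_trans (ler_normD _ _))// mulrDl lerD//.
  rewrite (le_trans (cM k))// ler_wpM2l// lerXn2r ?nnegrE// ?le_max ?M0//.
  by rewrite lexx.
rewrite (le_trans (dN k))// ler_wpM2l// lerXn2r ?nnegrE// ?le_max ?M0//.
by rewrite lexx orbT.
Qed.

Lemma expbndZ a c : expbnd c -> expbnd (fun k => a * c k).
Proof.
move=> [C [M [C0 M1 cM]]]; exists (`|a| * C), M; split => //.
  by rewrite mulr_ge0.
by move=> k; rewrite normrM -mulrA ler_wpM2l.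
Qed.

Lemma expbndS c : expbnd c -> expbnd (fun k => c k.+1).
Proof.
move=> [C [M [C0 M1 cM]]]; exists (C * M), M; split => //.
  by rewrite mulr_ge0// (le_trans ler01).
by move=> k; rewrite -mulrA -exprS.
Qed.

Lemma expbnd_le (c d : nat -> R) :
  (forall k, `|d k| <= `|c k|) -> expbnd c -> expbnd d.
Proof.
move=> dc [C [M [C0 M1 cM]]]; exists C, M; split => // k.
exact: le_trans (dc k) (cM k).
Qed.

Lemma expbnd_delay p c :
  expbnd c -> expbnd (fun k => if (k < p)%N then 0 else c (k - p)%N).
Proof.
move=> [C [M [C0 M1 cM]]]; exists C, M; split => // k.
have M0 : 0 <= M := le_trans ler01 M1.
case: ltnP => pk; first by rewrite normr0 mulr_ge0// exprn_ge0.
by rewrite (le_trans (cM _))// ler_wpM2l// ler_weXn2l// leq_subr.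
Qed.

Lemma expser_cvg c x : expbnd c ->
  pseries (fun k => k`!%:R^-1 * c k) x @ \oo --> expser c x.
Proof.
move=> [C [M [C0 M1 cM]]].
have M0 : 0 <= M := le_trans ler01 M1.
apply: normed_cvg.
apply: (@series_le_cvg R _ (C *: exp_coeff (M * `|x|))) => //=.
- by move=> k; rewrite /exp_coeff mulr_ge0// divr_ge0// exprn_ge0// mulr_ge0.
- move=> k; rewrite !normrM normrX normfV normr_nat /exp_coeff /=.
  rewrite [leRHS](_ : _ = k`!%:R^-1 * (C * M ^+ k) * `|x| ^+ k); last first.
    rewrite fctE /= exprMn /GRing.scale /=; ring.
  by rewrite ler_wpM2r ?exprn_ge0// ler_wpM2l// invr_ge0.
- by apply: is_cvg_seriesZ; exact: is_cvg_series_exp_coeff.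
Qed.

Arguments expser_cvg [c] x _.

Lemma eq_fun_cvgn (u v : nat -> R) (l : R) :
  u =1 v -> u @ \oo --> l -> v @ \oo --> l.
Proof. by move=> /funext->. Qed.

Lemma expserD c d x : expbnd c -> expbnd d ->
  expser (fun k => c k + d k) x = expser c x + expser d x.
Proof.
move=> cb db; apply: cvg_lim => //.
have H := cvgD (expser_cvg x cb) (expser_cvg x db).
apply: (eq_fun_cvgn _ (H _)) => n /=.
rewrite fctE /pseries /series /= -big_split; apply: eq_bigr => k _ /=.
by ring.
Qed.

Lemma expserZ a c x : expbnd c -> expser (fun k => a * c k) x = a * expser c x.
Proof.
move=> cb; apply: cvg_lim => //.
have H : (fun n => a * pseries (fun k => k`!%:R^-1 * c k) x n) @ \oo --> a * expser c x.
  by apply: cvgM; [exact: cvg_cst|exact: expser_cvg].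
apply: (eq_fun_cvgn _ H) => n /=.
rewrite /pseries /series /= mulr_sumr; apply: eq_bigr => k _ /=.
by ring.
Qed.

Lemma expser0 c : expbnd c -> expser c 0 = c 0%N.
Proof.
move=> cb; apply: cvg_lim => //.
rewrite -(cvg_shiftS) /=.
under eq_fun => n.
  rewrite /pseries /series /= big_nat_recl// big1 ?addr0; last first.
    by move=> k _; rewrite expr0n mulr0.
  rewrite fact0 invr1 mul1r expr0 mulr1. over.
exact: cvg_cst.
Qed.

Lemma is_derive_expser c x : expbnd c ->
  is_derive x 1 (expser c) (expser (fun k => c k.+1) x).
Proof.
move=> cb.
have dE d : pseries_diffs (fun k => k`!%:R^-1 * d k) =
    (fun k => k`!%:R^-1 * d k.+1) :> (nat -> R).
  apply/funext => k; rewrite /pseries_diffs factS natrM invfM mulrA.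
  by congr (_ * _); rewrite mulrA mulfV ?mul1r.
rewrite /expser -dE.
(* The radius |x| + 1 is just some point beyond |x|. The series and its first two formal derivatives
   converge there, because [expbnd] is stable under shifts. *)
apply: (@pseries_snd_diffs _ _ (`|x| + 1)).
- by apply/cvg_ex; eexists; apply: expser_cvg.
- by rewrite dE; apply/cvg_ex; eexists; apply: expser_cvg; exact: expbndS.
- rewrite dE dE; apply/cvg_ex; eexists; apply: expser_cvg.
  exact: (expbndS (expbndS cb)).
- by rewrite [ltRHS]ger0_norm ?addr_ge0// ltrDl.
Qed.

(** The first p terms vanish and x^p factors out of the others. The weight k!/(k+p)! replaces the
    built-in 1/k! by the 1/(k+p)! of phi_p; it is at most 1, so the growth bound survives. *)
Lemma expser_delay p c x : expbnd c ->
  expser (fun k => if (k < p)%N then 0 else c (k - p)%N) x =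
  x ^+ p * expser (fun k => k`!%:R / (k + p)`!%:R * c k) x.
Proof.
move=> cb; apply: cvg_lim => //.
rewrite -(cvg_shiftn p) /=.
have cb' : expbnd (fun k => k`!%:R / (k + p)`!%:R * c k).
  apply: expbnd_le cb => k; rewrite normrM ler_piMl//.
  rewrite ger0_norm ?divr_ge0// ler_pdivrMr ?ltr0n ?fact_gt0// mul1r.
  by rewrite ler_nat leq_fact// leq_addr.
have H : (fun n => x ^+ p *
      pseries (fun k => k`!%:R^-1 * (k`!%:R / (k + p)`!%:R * c k)) x n) @ \oo -->
    x ^+ p * expser (fun k => k`!%:R / (k + p)`!%:R * c k) x.
  by apply: cvgM; [exact: cvg_cst|exact: expser_cvg].
apply: (eq_fun_cvgn _ H) => n /=.
rewrite /pseries /series /= [RHS](big_cat_nat (n := p)) ?leq_addl//=.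
rewrite [X in _ = X + _]big1_seq ?add0r; last first.
  by move=> k; rewrite mem_index_iota; case: ltnP => [_ _|]; rewrite ?mulr0 ?mul0r ?andbF.
rewrite -{3}(add0n p) big_addn addnK mulr_sumr; apply: eq_bigr => k _.
rewrite ltnNge leq_addl /= addnK exprD.
have k0 : k`!%:R != 0 :> R by rewrite pnatr_eq0 -lt0n fact_gt0.
(* The pair of k! and its inverse, present only on the left, is inserted on the right, since [ring]
   does not cancel it. *)
by rewrite -[in RHS](mulVKf k0 (c k)); ring.
Qed.
End RealExponentialSeries.

(** * Series with complex coefficients in a real variable *)

Section ComplexExponentialSeries.
Variable R : realType.
Local Notation Re := (@complex.Re R).
Local Notation Im := (@complex.Im R).
Implicit Types (b : nat -> R[i]) (x : R) (a z w : R[i]).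

Lemma ReD z w : Re (z + w) = Re z + Re w. Proof. by case: z; case: w. Qed.
Lemma ImD z w : Im (z + w) = Im z + Im w. Proof. by case: z; case: w. Qed.
Lemma ReM z w : Re (z * w) = Re z * Re w - Im z * Im w.
Proof. by case: z; case: w. Qed.
Lemma ImM z w : Im (z * w) = Re z * Im w + Im z * Re w.
Proof. by case: z; case: w. Qed.
Lemma Re_sum I (r : seq I) (P : pred I) (F : I -> R[i]) :
  Re (\sum_(i <- r | P i) F i) = \sum_(i <- r | P i) Re (F i).
Proof. by elim/big_rec2: _ => // i y1 y2 _ <-; rewrite ReD. Qed.
Lemma Im_sum I (r : seq I) (P : pred I) (F : I -> R[i]) :
  Im (\sum_(i <- r | P i) F i) = \sum_(i <- r | P i) Im (F i).
Proof. by elim/big_rec2: _ => // i y1 y2 _ <-; rewrite ImD. Qed.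

Lemma complex_eqP z w : Re z = Re w -> Im z = Im w -> z = w.
Proof. by case: z; case: w => ? ? ? ? /= -> ->. Qed.

Definition cxbnd b := expbnd (Re \o b) /\ expbnd (Im \o b).

(** As the variable x is real, the real and imaginary parts of the sum are themselves real series,
    and both convergence and differentiation reduce to [expser]. *)
Definition cxser b x : R[i] := expser (Re \o b) x +i* expser (Im \o b) x.

Lemma cxbndD b c : cxbnd b -> cxbnd c -> cxbnd (fun k => b k + c k).
Proof.
move=> [b1 b2] [c1 c2]; split.
  by rewrite (_ : _ \o _ = fun k => Re (b k) + Re (c k));
    [exact: expbndD|apply/funext => k /=; rewrite ReD].
by rewrite (_ : _ \o _ = fun k => Im (b k) + Im (c k));
  [exact: expbndD|apply/funext => k /=; rewrite ImD].
Qed.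

Lemma cxserD b c x : cxbnd b -> cxbnd c ->
  cxser (fun k => b k + c k) x = cxser b x + cxser c x.
Proof.
move=> [b1 b2] [c1 c2]; apply: complex_eqP; rewrite ?ReD ?ImD /= -expserD//;
  by congr (expser _ _); apply/funext => k /=; rewrite ?ReD ?ImD.
Qed.

Let ReZE a b : Re \o (fun k => a * b k) =
  (fun k => Re a * (Re \o b) k + - Im a * (Im \o b) k).
Proof. by apply/funext => k /=; rewrite ReM mulNr. Qed.

Let ImZE a b : Im \o (fun k => a * b k) =
  (fun k => Re a * (Im \o b) k + Im a * (Re \o b) k).
Proof. by apply/funext => k /=; rewrite ImM. Qed.

Lemma cxbndZ a b : cxbnd b -> cxbnd (fun k => a * b k).
Proof.
by move=> [b1 b2]; split; rewrite ?ReZE ?ImZE; apply: expbndD; apply: expbndZ.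
Qed.

Lemma cxserZ a b x : cxbnd b -> cxser (fun k => a * b k) x = a * cxser b x.
Proof.
move=> [b1 b2]; apply: complex_eqP; rewrite ?ReM ?ImM /= ?ReZE ?ImZE.
  by rewrite expserD ?expserZ ?mulNr//; exact: expbndZ.
by rewrite expserD ?expserZ//; exact: expbndZ.
Qed.

Lemma cxbnd0 : cxbnd (fun=> 0).
Proof.
by split; exists 0, 1; split => //= k; rewrite normr0 mul0r.
Qed.

Lemma cxser0 x : cxser (fun=> 0) x = 0.
Proof.
have := cxserZ 0 x cxbnd0; rewrite [RHS]mul0r => H; rewrite -[RHS]H.
by congr (cxser _ _); apply/funext => k; rewrite mul0r.
Qed.

Lemma cxbnd_sum (I : Type) (r : seq I) (F : I -> nat -> R[i]) :
  (forall i, cxbnd (F i)) -> cxbnd (fun k => \sum_(i <- r) F i k).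
Proof.
move=> Fb; elim: r => [|i r IH].
  by under eq_fun do rewrite big_nil; exact: cxbnd0.
by under eq_fun do rewrite big_cons; exact: cxbndD.
Qed.

Lemma cxser_sum (I : Type) (r : seq I) (F : I -> nat -> R[i]) x :
  (forall i, cxbnd (F i)) ->
  cxser (fun k => \sum_(i <- r) F i k) x = \sum_(i <- r) cxser (F i) x.
Proof.
move=> Fb; elim: r => [|i r IH].
  by under eq_fun do rewrite big_nil; rewrite big_nil cxser0.
under eq_fun do rewrite big_cons; rewrite cxserD//; last exact: cxbnd_sum.
by rewrite IH big_cons.
Qed.

(** * Series with matrix coefficients, treated entrywise *)

Definition mxbnd m n (B : nat -> 'M[R[i]]_(m, n)) :=
  forall i j, cxbnd (fun k => B k i j).

Definition mxser m n (B : nat -> 'M[R[i]]_(m, n)) x : 'M[R[i]]_(m, n) :=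
  \matrix_(i, j) cxser (fun k => B k i j) x.

Lemma mxbndD m n (B C : nat -> 'M[R[i]]_(m, n)) :
  mxbnd B -> mxbnd C -> mxbnd (fun k => B k + C k).
Proof.
by move=> Bb Cb i j; under eq_fun do rewrite mxE; exact: cxbndD.
Qed.

Lemma mxserD m n (B C : nat -> 'M[R[i]]_(m, n)) x :
  mxbnd B -> mxbnd C -> mxser (fun k => B k + C k) x = mxser B x + mxser C x.
Proof.
move=> Bb Cb; apply/matrixP => i j; rewrite !mxE -cxserD//.
by under eq_fun do rewrite mxE.
Qed.

Lemma mxbndZ m n a (B : nat -> 'M[R[i]]_(m, n)) :
  mxbnd B -> mxbnd (fun k => a *: B k).
Proof.
by move=> Bb i j; under eq_fun do rewrite mxE; exact: cxbndZ.
Qed.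

Lemma mxserZ m n a (B : nat -> 'M[R[i]]_(m, n)) x :
  mxbnd B -> mxser (fun k => a *: B k) x = a *: mxser B x.
Proof.
move=> Bb; apply/matrixP => i j; rewrite !mxE -cxserZ//.
by under eq_fun do rewrite mxE.
Qed.

Lemma mxbnd_mull l m n (P : 'M[R[i]]_(l, m)) (B : nat -> 'M[R[i]]_(m, n)) :
  mxbnd B -> mxbnd (fun k => P *m B k).
Proof.
move=> Bb i j; under eq_fun do rewrite mxE.
by apply: cxbnd_sum => k; exact: cxbndZ.
Qed.

Lemma mxser_mull l m n (P : 'M[R[i]]_(l, m)) (B : nat -> 'M[R[i]]_(m, n)) x :
  mxbnd B -> mxser (fun k => P *m B k) x = P *m mxser B x.
Proof.
move=> Bb; apply/matrixP => i j; rewrite !mxE.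
under eq_fun do rewrite mxE; rewrite cxser_sum => [|k]; last exact: cxbndZ.
by apply: eq_bigr => k _; rewrite cxserZ// mxE.
Qed.

Lemma mxbnd_mulr l m n (B : nat -> 'M[R[i]]_(l, m)) (P : 'M[R[i]]_(m, n)) :
  mxbnd B -> mxbnd (fun k => B k *m P).
Proof.
move=> Bb i j; under eq_fun do rewrite mxE.
apply: cxbnd_sum => k; under eq_fun do rewrite mulrC; exact: cxbndZ.
Qed.

Lemma mxser_mulr l m n (B : nat -> 'M[R[i]]_(l, m)) (P : 'M[R[i]]_(m, n)) x :
  mxbnd B -> mxser (fun k => B k *m P) x = mxser B x *m P.
Proof.
move=> Bb; apply/matrixP => i j; rewrite !mxE.
under eq_fun do rewrite mxE; rewrite cxser_sum => [|k].
  apply: eq_bigr => k _; rewrite mxE [RHS]mulrC -cxserZ//.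
  by under eq_fun do rewrite mulrC.
by under eq_fun do rewrite mulrC; exact: cxbndZ.
Qed.

Lemma mxser0 m n (B : nat -> 'M[R[i]]_(m, n)) : mxbnd B -> mxser B 0 = B 0%N.
Proof.
move=> Bb; apply/matrixP => i j; rewrite !mxE.
by have [b1 b2] := Bb i j; apply: complex_eqP; rewrite /= expser0.
Qed.

Lemma mxbndS m n (B : nat -> 'M[R[i]]_(m, n)) :
  mxbnd B -> mxbnd (fun k => B k.+1).
Proof.
by move=> Bb i j; have [b1 b2] := Bb i j; split;
  [exact: (expbndS b1)|exact: (expbndS b2)].
Qed.

(* If B k = A ^+ k, these are the coefficients of s^p phi_p(sA), by [phimxE]. *)
Definition mxdelay m n p (B : nat -> 'M[R[i]]_(m, n)) k :=
  if (k < p)%N then 0 else B (k - p)%N.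

Lemma mxbnd_delay m n p (B : nat -> 'M[R[i]]_(m, n)) :
  mxbnd B -> mxbnd (mxdelay p B).
Proof.
move=> Bb i j; have [b1 b2] := Bb i j; split.
  rewrite (_ : _ \o _ = fun k => if (k < p)%N then 0 else Re (B (k - p)%N i j)).
    exact: (expbnd_delay p b1).
  by apply/funext => k /=; rewrite /mxdelay; case: ifP; rewrite ?mxE.
rewrite (_ : _ \o _ = fun k => if (k < p)%N then 0 else Im (B (k - p)%N i j)).
  exact: (expbnd_delay p b2).
by apply/funext => k /=; rewrite /mxdelay; case: ifP; rewrite ?mxE.
Qed.

Lemma ReZ (a : R) z : Re (a%:C * z) = a * Re z.
Proof. by rewrite ReM /= mul0r subr0. Qed.

Lemma ImZ (a : R) z : Im (a%:C * z) = a * Im z.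
Proof. by rewrite ImM /= mul0r addr0. Qed.

Lemma mxser_delay m n p (B : nat -> 'M[R[i]]_(m, n)) x : mxbnd B ->
  mxser (mxdelay p B) x =
  (x ^+ p)%:C *: mxser (fun k => (k`!%:R / (k + p)`!%:R : R)%:C *: B k) x.
Proof.
move=> Bb; apply/matrixP => i j; rewrite !mxE.
have [b1 b2] := Bb i j; apply: complex_eqP; rewrite ?ReZ ?ImZ /=.
  under [X in _ = _ * expser X _]eq_fun do rewrite /= mxE ReZ.
  rewrite -(expser_delay p x b1); congr (expser _ _).
  by apply/funext => k /=; rewrite /mxdelay; case: ifP; rewrite ?mxE.
under [X in _ = _ * expser X _]eq_fun do rewrite /= mxE ImZ.
rewrite -(expser_delay p x b2); congr (expser _ _).
by apply/funext => k /=; rewrite /mxdelay; case: ifP; rewrite ?mxE.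
Qed.

Lemma Re_le_normc z : `|Re z| <= Normc.normc z.
Proof.
case: z => u v /=; rewrite -sqrtr_sqr ler_wsqrtr// lerDl sqr_ge0 //.
Qed.

Lemma Im_le_normc z : `|Im z| <= Normc.normc z.
Proof.
case: z => u v /=; rewrite -sqrtr_sqr ler_wsqrtr// lerDr sqr_ge0 //.
Qed.

Lemma normc_ge0 z : 0 <= Normc.normc z.
Proof. by case: z => u v; exact: sqrtr_ge0. Qed.

Lemma le_normc_Re_Im z : Normc.normc z <= `|Re z| + `|Im z|.
Proof.
case: z => u v /=; rewrite -[leRHS]ger0_norm ?addr_ge0// -sqrtr_sqr.
by rewrite ler_wsqrtr// sqrrD !real_normK ?num_real// lerD2r lerDl mulrn_wge0// mulr_ge0.
Qed.

Lemma normc_sum I (r : seq I) (F : I -> R[i]) :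
  Normc.normc (\sum_(i <- r) F i) <= \sum_(i <- r) Normc.normc (F i).
Proof.
elim: r => [|i r IH]; first by rewrite !big_nil Normc.normc0.
by rewrite !big_cons (le_trans (le_normcD _ _))// lerD2l.
Qed.

Lemma mxbnd_exp n (A : 'M[R[i]]_n) : mxbnd (fun k => A ^+ k).
Proof.
(* M dominates every absolute row sum of A, so each further factor A multiplies the entrywise bound
   by at most M. The summand 1 provides the 1 <= M that [expbnd] asks for. *)
set M := 1 + \sum_i \sum_j Normc.normc (A i j).
have S0 i : 0 <= \sum_j Normc.normc (A i j).
  by apply: sumr_ge0 => j _; exact: normc_ge0.
have M1 : 1 <= M by rewrite lerDl; apply: sumr_ge0 => i _.
have M0 : 0 <= M := le_trans ler01 M1.
have AM k : forall i j, Normc.normc ((A ^+ k) i j) <= 1 * M ^+ k.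
  rewrite mul1r; elim: k => [|k IH] i j.
    rewrite !expr0 mxE; case: (_ == _); first by rewrite mulr1n Normc.normc1.
    by rewrite mulr0n Normc.normc0.
  rewrite [A ^+ _]exprS -[A * _]/(A *m A ^+ k) mxE (le_trans (normc_sum _ _))//.
  rewrite (@le_trans _ _ (\sum_l Normc.normc (A i l) * M ^+ k))//.
    apply: ler_sum => l _; rewrite Normc.normcM ler_wpM2l ?IH//.
    exact: normc_ge0.
  rewrite -mulr_suml exprS ler_wpM2r ?exprn_ge0//.
  rewrite /M [X in 1 + X](bigD1 i)//= addrCA lerDl addr_ge0// sumr_ge0//.
by move=> i j; split; exists 1, M; split => // k /=;
  rewrite (le_trans _ (AM k i j)) ?Re_le_normc ?Im_le_normc.
Qed.

(** Connects the limits in [expmx] and [phimx], taken in the topology of complex matrices, with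
    limits of real sequences. A neighbourhood of L contains a product of neighbourhoods of its
    finitely many entries, and an entry is within e once its real and imaginary parts are within
    e/2. *)
Lemma cvg_mx m n (u : nat -> 'M[R[i]]_(m, n)) (L : 'M[R[i]]_(m, n)) :
  (forall i j, (fun k => Re (u k i j)) @ \oo --> Re (L i j)) ->
  (forall i j, (fun k => Im (u k i j)) @ \oo --> Im (L i j)) ->
  lim (u @ \oo) = L.
Proof.
move=> uRe uIm; apply: cvg_lim; first exact: norm_hausdorff.
move=> S [P LP PS].
suff H : \forall k \near \oo, forall i j, P i j (u k i j).
  by move: H; apply: filterS => k; exact: PS.
apply: filter_forall => i; apply: filter_forall => j.
suff : (fun k => u k i j) @ \oo --> L i j by apply; exact: LP.
apply/(@cvgrPdist_lt _ R[i]) => e e0.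
(* The radius e is an element of R[i]; being positive, it is real. *)
have [e' e'E] : exists e', e = e'%:C.
  by exists (Re e); rewrite RRe_real// gtr0_real.
have e'0 : 0 < e' / 2 by rewrite divr_gt0// -ltcR -e'E.
have /cvgrPdist_lt /(_ _ e'0) H1 := uRe i j.
have /cvgrPdist_lt /(_ _ e'0) H2 := uIm i j.
near=> k.
rewrite e'E; change `|L i j - u k i j| with (Normc.normc (L i j - u k i j))%:C.
rewrite ltcR (le_lt_trans (le_normc_Re_Im _))//.
rewrite [ltRHS](splitr e') ltrD//.
  rewrite (_ : Re _ = Re (L i j) - Re (u k i j)); last by case: (L i j); case: (u k i j).
  by near: k.
rewrite (_ : Im _ = Im (L i j) - Im (u k i j)); last by case: (L i j); case: (u k i j).
by near: k.
Unshelve. all: by end_near. Qed.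

Lemma lim_mxser m n (B : nat -> 'M[R[i]]_(m, n)) x : mxbnd B ->
  lim (series (fun k => (k`!%:R^-1 * x ^+ k)%:C *: B k) @ \oo) = mxser B x.
Proof.
move=> Bb; apply: cvg_mx => i j; have [b1 b2] := Bb i j.
  rewrite mxE [Re _]/(expser _ x); refine (eq_fun_cvgn _ (@expser_cvg _ _ x b1)) => k.
  rewrite /series /pseries /= summxE Re_sum; apply: eq_bigr => l _.
  by rewrite mxE ReZ /=; ring.
rewrite mxE [Im _]/(expser _ x); refine (eq_fun_cvgn _ (@expser_cvg _ _ x b2)) => k.
rewrite /series /pseries /= summxE Im_sum; apply: eq_bigr => l _.
by rewrite mxE ImZ /=; ring.
Qed.

Lemma exp_scalemx n (A : 'M[R[i]]_n) a k : (a *: A) ^+ k = a ^+ k *: A ^+ k.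
Proof.
elim: k => [|k IH]; first by rewrite !expr0 scale1r.
rewrite !exprS IH.
change ((a *: A) *m (a ^+ k *: A ^+ k) = (a * a ^+ k) *: (A *m A ^+ k)).
by rewrite -scalemxAl -scalemxAr scalerA.
Qed.

Lemma rCX (y : R) k : (y ^+ k)%:C = y%:C ^+ k.
Proof. exact: rmorphXn. Qed.

Lemma expmxE n (A : 'M[R[i]]_n) x :
  expmx (x%:C *: A) = mxser (fun k => A ^+ k) x.
Proof.
rewrite -lim_mxser; last exact: mxbnd_exp.
congr (lim (series _ @ \oo)); apply/funext => k.
by rewrite exp_scalemx scalerA rmorphM /= fmorphV /= rmorph_nat rCX.
Qed.

(** Multiplication by x^p removes the weights k!/(k+p)!: with respect to x^k/k! the coefficients
    become plain powers of A, delayed by p. *)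
Lemma phimxE p n (A : 'M[R[i]]_n) x :
  (x ^+ p)%:C *: phimx p (x%:C *: A) = mxser (mxdelay p (fun k => A ^+ k)) x.
Proof.
rewrite mxser_delay; last exact: mxbnd_exp.
congr (_ *: _); rewrite -lim_mxser; last first.
  move=> i j; have [b1 b2] := mxbnd_exp A i j.
  have le1 k : `|k`!%:R / (k + p)`!%:R : R| <= 1.
    rewrite ger0_norm ?divr_ge0// ler_pdivrMr ?ltr0n ?fact_gt0// mul1r.
    by rewrite ler_nat leq_fact// leq_addr.
  split; [apply: expbnd_le b1|apply: expbnd_le b2] => k /=;
    by rewrite mxE ?ReZ ?ImZ normrM ler_piMl.
congr (lim (series _ @ \oo)); apply/funext => k.
rewrite exp_scalemx !scalerA; congr (_ *: _).
rewrite -rmorphM /= -rCX -(rmorph_nat (real_complex R)) -fmorphV -rmorphM /=.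
congr (_ %:C); have k0 : k`!%:R != 0 :> R by rewrite pnatr_eq0 -lt0n fact_gt0.
by field; rewrite k0 pnatr_eq0 -lt0n fact_gt0.
Qed.

End ComplexExponentialSeries.

(** * The Euclidean norm *)

Section Norms.
Variable R : realType.
Local Notation Re := (@complex.Re R).
Local Notation Im := (@complex.Im R).

(** The real part of the Hermitian inner product, that is, the inner product of C^n regarded as
    R^(2n). *)
Definition redot n (x y : 'cV[R[i]]_n) : R :=
  \sum_i (Re (x i 0) * Re (y i 0) + Im (x i 0) * Im (y i 0)).

Lemma normc_sqr (z : R[i]) : Normc.normc z ^+ 2 = Re z ^+ 2 + Im z ^+ 2.
Proof. by case: z => u v /=; rewrite sqr_sqrtr// addr_ge0// sqr_ge0. Qed.

Lemma norm2_ge0 n (x : 'cV[R[i]]_n) : 0 <= norm2 x.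
Proof. exact: sqrtr_ge0. Qed.

Lemma norm2_sqr n (x : 'cV[R[i]]_n) : norm2 x ^+ 2 = redot x x.
Proof.
rewrite sqr_sqrtr; last by apply: sumr_ge0 => i _; exact: sqr_ge0.
by apply: eq_bigr => i _; rewrite normc_sqr !expr2.
Qed.

Lemma norm2_0 n : norm2 (0 : 'cV[R[i]]_n) = 0.
Proof.
rewrite /norm2 big1 ?sqrtr0// => i _; rewrite mxE Normc.normc0 expr0n//.
Qed.

Lemma norm2_eq0 n (x : 'cV[R[i]]_n) : norm2 x = 0 -> x = 0.
Proof.
move=> x0; have := norm2_sqr x; rewrite x0 expr0n /= => /esym/eqP.
rewrite psumr_eq0 => [/allP H|i _]; last by rewrite addr_ge0// -expr2 sqr_ge0.
apply/matrixP => i j; rewrite !ord1 mxE.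
have /= := H i (mem_index_enum i); rewrite paddr_eq0 -?expr2 ?sqr_ge0// !sqrf_eq0.
by case: (x i 0) => u v /= /andP[/eqP-> /eqP->].
Qed.

Lemma redot_lin n (a b : R) (x y : 'cV[R[i]]_n) :
  redot (a%:C *: x + b%:C *: y) (a%:C *: x + b%:C *: y) =
  a ^+ 2 * redot x x + 2 * (a * b * redot x y) + b ^+ 2 * redot y y.
Proof.
rewrite /redot !mulr_sumr -!big_split; apply: eq_bigr => i _ /=.
by rewrite !mxE !(ReD, ImD, ReZ, ImZ); ring.
Qed.

(** Cauchy-Schwarz: the squared norm of ||y|| x - ||x|| y equals 2 ||x|| ||y|| (||x|| ||y|| -
    [redot x y]). The cases x = 0 and y = 0 are split off so that the positive factor can be
    cancelled. *)
Lemma redot_le n (x y : 'cV[R[i]]_n) : redot x y <= norm2 x * norm2 y.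
Proof.
have := norm2_ge0 x; rewrite le_eqVlt => /predU1P[x0|x0].
  rewrite -x0 mul0r (norm2_eq0 (esym x0)) /redot big1// => i _.
  by rewrite mxE /= !mul0r addr0.
have := norm2_ge0 y; rewrite le_eqVlt => /predU1P[y0|y0].
  rewrite -y0 mulr0 (norm2_eq0 (esym y0)) /redot big1// => i _.
  by rewrite mxE /= !mulr0 addr0.
have : 0 <= redot ((norm2 y)%:C *: x + (- norm2 x)%:C *: y)
                  ((norm2 y)%:C *: x + (- norm2 x)%:C *: y).
  by rewrite -norm2_sqr sqr_ge0.
rewrite redot_lin -!norm2_sqr.
have -> : norm2 y ^+ 2 * norm2 x ^+ 2 +
    2 * (norm2 y * - norm2 x * redot x y) + (- norm2 x) ^+ 2 * norm2 y ^+ 2 =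
  2 * (norm2 x * norm2 y) * (norm2 x * norm2 y - redot x y) by ring.
by rewrite pmulr_rge0 ?subr_ge0// !mulr_gt0.
Qed.

Lemma norm2D n (x y : 'cV[R[i]]_n) : norm2 (x + y) <= norm2 x + norm2 y.
Proof.
rewrite -ler_sqr ?nnegrE ?addr_ge0 ?norm2_ge0//.
have /= := redot_lin 1 1 x y; rewrite !scale1r norm2_sqr => ->.
have := redot_le x y; rewrite sqrrD !norm2_sqr; lra.
Qed.

Lemma norm2Z n (c : R[i]) (x : 'cV[R[i]]_n) :
  norm2 (c *: x) = Normc.normc c * norm2 x.
Proof.
rewrite -[Normc.normc c]ger0_norm ?normc_ge0// -sqrtr_sqr -sqrtrM ?sqr_ge0//.
congr Num.sqrt; rewrite mulr_sumr; apply: eq_bigr => i _.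
by rewrite mxE Normc.normcM exprMn.
Qed.

Lemma normc_real (a : R) : Normc.normc a%:C = `|a|.
Proof. by rewrite /= expr0n addr0 sqrtr_sqr. Qed.

Lemma norm2N n (x : 'cV[R[i]]_n) : norm2 (- x) = norm2 x.
Proof.
have -> : - x = (-1)%:C *: x by rewrite rmorphN /= scaleNr scale1r.
by rewrite norm2Z normc_real normrN normr1 mul1r.
Qed.

Lemma normc_le_norm2 n (x : 'cV[R[i]]_n) i : Normc.normc (x i 0) <= norm2 x.
Proof.
rewrite -[leLHS]ger0_norm ?normc_ge0// -sqrtr_sqr ler_wsqrtr//.
by rewrite (bigD1 i)//= lerDl sumr_ge0// => j _; exact: sqr_ge0.
Qed.

Lemma norm2_unitv n (i : 'I_n) : norm2 (unitv R i) = 1.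
Proof.
rewrite /norm2 (bigD1 i)//= big1 ?addr0.
  by rewrite mxE !eqxx Normc.normc1 expr1n sqrtr1.
by move=> k ki; rewrite mxE (negbTE ki) Normc.normc0 expr0n.
Qed.

Lemma norm2_le_sum n (x : 'cV[R[i]]_n) :
  norm2 x <= \sum_i Normc.normc (x i 0).
Proof.
have -> : x = \sum_i x i 0 *: unitv R i.
  apply/matrixP => i j; rewrite ord1 summxE (bigD1 i)//= big1 ?addr0.
    by rewrite !mxE !eqxx mulr1.
  by move=> k ki; rewrite !mxE eq_sym (negbTE ki) mulr0.
have le I (r : seq I) (F : I -> 'cV[R[i]]_n) :
    norm2 (\sum_(i <- r) F i) <= \sum_(i <- r) norm2 (F i).
  elim: r => [|i r IH]; first by rewrite !big_nil norm2_0.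
  by rewrite !big_cons (le_trans (norm2D _ _))// lerD2l.
rewrite (le_trans (le _ _ _))//; apply: ler_sum => i _.
(* The expansion of x was substituted on the right-hand side as well; there its i-th entry has to be
   evaluated back to [x i 0]. *)
rewrite norm2Z norm2_unitv mulr1 summxE (bigD1 i)//= big1 ?addr0.
  by rewrite !mxE !eqxx mulr1.
by move=> k ki; rewrite !mxE eq_sym (negbTE ki) mulr0.
Qed.

(** * The spectral norm as an operator norm *)

Local Notation specset M :=
  [set norm2 (M *m x) | x in [set x : 'cV[R[i]]_(_) | norm2 x <= 1]].

(** A crude bound that serves twice: it makes the supremum in [specnorm] a genuine one, and it
    controls [specnorm] by the entries in [specnorm_dist]. *)
Lemma specset_ub m n (M : 'M[R[i]]_(m, n)) :
  ubound (specset M) (\sum_i \sum_j Normc.normc (M i j)).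
Proof.
move=> _ [x /= x1 <-]; rewrite (le_trans (norm2_le_sum _))//.
apply: ler_sum => i _; rewrite mxE (le_trans (normc_sum _ _))//.
apply: ler_sum => j _; rewrite Normc.normcM ler_piMr ?normc_ge0//.
exact: le_trans (normc_le_norm2 _ _) x1.
Qed.

Lemma specset_has_sup m n (M : 'M[R[i]]_(m, n)) : has_sup (specset M).
Proof.
split; last by eexists; exact: specset_ub.
by exists (norm2 (M *m 0)), 0 => //=; rewrite norm2_0.
Qed.

Lemma specnorm_ge m n (M : 'M[R[i]]_(m, n)) x :
  norm2 x <= 1 -> norm2 (M *m x) <= specnorm M.
Proof.
by move=> x1; apply: (ub_le_sup (specset_has_sup M).2); exists x.
Qed.

Lemma specnorm_ge0 m n (M : 'M[R[i]]_(m, n)) : 0 <= specnorm M.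
Proof.
have := @specnorm_ge _ _ M 0; rewrite mulmx0 !norm2_0; exact.
Qed.

Lemma specnorm_le m n (M : 'M[R[i]]_(m, n)) a :
  (forall x, norm2 x <= 1 -> norm2 (M *m x) <= a) -> specnorm M <= a.
Proof.
move=> H; apply: ge_sup; first by have [] := specset_has_sup M.
by move=> _ [x /= x1 <-]; exact: H.
Qed.

Lemma norm2_mulmx m n (M : 'M[R[i]]_(m, n)) x :
  norm2 (M *m x) <= specnorm M * norm2 x.
Proof.
have := norm2_ge0 x; rewrite le_eqVlt => /predU1P[x0|x0].
  by rewrite (norm2_eq0 (esym x0)) mulmx0 !norm2_0 mulr0.
have xE : x = (norm2 x)%:C *: ((norm2 x)^-1%:C *: x).
  by rewrite scalerA -rmorphM /= mulfV ?gt_eqF// scale1r.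
have x1 : norm2 ((norm2 x)^-1%:C *: x) <= 1.
  by rewrite norm2Z normc_real normfV ger0_norm ?norm2_ge0// mulVf ?gt_eqF.
rewrite {1}xE -scalemxAr norm2Z normc_real ger0_norm ?norm2_ge0// mulrC.
by rewrite ler_wpM2r ?norm2_ge0// specnorm_ge.
Qed.

(** The reverse triangle inequality combined with the entrywise bound. It yields the continuity of s
    |-> ||e^(sA)||, hence that the maxima kappa_1 and kappa_2 are attained. *)
Lemma specnorm_dist m n (M N : 'M[R[i]]_(m, n)) :
  `|specnorm M - specnorm N| <= \sum_i \sum_j Normc.normc ((M - N) i j).
Proof.
have le (P Q : 'M[R[i]]_(m, n)) :
    specnorm P <= specnorm Q + \sum_i \sum_j Normc.normc ((P - Q) i j).
  apply: specnorm_le => x x1; rewrite -{1}(subrK Q P) addrC mulmxDl.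
  rewrite (le_trans (norm2D _ _))// lerD ?specnorm_ge//.
  by apply: specset_ub; exists x.
have sym : \sum_i \sum_j Normc.normc ((N - M) i j) =
    \sum_i \sum_j Normc.normc ((M - N) i j).
  apply: eq_bigr => i _; apply: eq_bigr => j _.
  by rewrite -opprB mxE normcN.
have := le M N; have := le N M; rewrite sym => NM MN.
by rewrite ler_norml; apply/andP; split; lra.
Qed.
End Norms.

(** * Derivatives and integrals of real functions *)

Section Calculus.
Variable R : realType.
Local Notation Re := (@complex.Re R).
Local Notation Im := (@complex.Im R).
Local Notation mu := (@lebesgue_measure R).

Lemma is_derive_sumfun n (h : 'I_n -> R -> R) (dh : 'I_n -> R) (x : R) :
  (forall i, is_derive x 1 (h i) (dh i)) ->
  is_derive x 1 (fun y => \sum_i h i y) (\sum_i dh i).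
Proof.
move=> H; rewrite (_ : (fun y => _) = \sum_i h i); first exact: is_derive_sum.
by apply/funext => y; rewrite fct_sumE.
Qed.

Lemma is_derive_mulfun (f g : R -> R) (x df dg : R) :
  is_derive x 1 f df -> is_derive x 1 g dg ->
  is_derive x 1 (fun y => f y * g y) (df * g x + f x * dg).
Proof.
move=> Hf Hg; apply: (is_derive_eq (is_deriveM Hf Hg)).
by rewrite /GRing.scale /=; ring.
Qed.

Lemma is_derive_addfun (f g : R -> R) (x df dg : R) :
  is_derive x 1 f df -> is_derive x 1 g dg ->
  is_derive x 1 (fun y => f y + g y) (df + dg).
Proof. by move=> Hf Hg; exact: (is_deriveD Hf Hg). Qed.

Lemma is_derive_subfun (f g : R -> R) (x df dg : R) :
  is_derive x 1 f df -> is_derive x 1 g dg ->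
  is_derive x 1 (fun y => f y - g y) (df - dg).
Proof. by move=> Hf Hg; exact: (is_deriveB Hf Hg). Qed.

Lemma is_derive_scalefun (a : R) (f : R -> R) (x df : R) :
  is_derive x 1 f df -> is_derive x 1 (fun y => a * f y) (a * df).
Proof. by move=> Hf; exact: (is_deriveZ a Hf). Qed.

Lemma is_derive_continuous (f : R -> R) (df : R -> R) :
  (forall x : R, is_derive x 1 f (df x)) -> continuous f.
Proof.
move=> H x; apply: differentiable_continuous; apply/derivable1_diffP.
by have [] := H x.
Qed.

Lemma continuous_integrable (f : R -> R) (a b : R) :
  continuous f -> mu.-integrable `[a, b] (EFin \o f).
Proof.
move=> cf; apply: continuous_compact_integrable; first exact: segment_compact.
exact: continuous_subspaceT.
Qed.

Lemma Rintegral_FTC (F f : R -> R) (a b : R) : a < b ->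
  (forall x : R, is_derive x 1 F (f x)) -> continuous f ->
  \int[mu]_(x in `[a, b]) f x = F b - F a.
Proof.
move=> ab dF cf; have cF := is_derive_continuous dF.
rewrite /Rintegral (continuous_FTC2 (F := F) ab) //=.
- exact: continuous_subspaceT.
- split; first by move=> x _; have [] := dF x.
    by apply: cvg_at_right_filter; exact: cF.
  by apply: cvg_at_left_filter; exact: cF.
- by move=> x _; rewrite derive1E; apply: derive_val.
Qed.

Lemma is_derive_monomial p (x : R) :
  is_derive x 1 (fun r : R => r ^+ p.+1 / p.+1`!%:R) (x ^+ p / p`!%:R).
Proof.
under eq_fun do rewrite mulrC.
rewrite [X in is_derive _ _ _ X](_ : _ = p.+1`!%:R^-1 * (p.+1%:R * x ^+ p)).
  apply: is_derive_scalefun.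
  have := @is_deriveX _ _ id p.+1 x 1 1 (is_derive_id x (1 : R)).
  rewrite /GRing.scale /= mulr1.
  by rewrite (_ : id ^+ _ = fun r : R => r ^+ p.+1)//; apply/funext => r; rewrite fctE.
rewrite factS natrM; field.
by rewrite nat1r !pnatr_eq0 -lt0n fact_gt0.
Qed.

Lemma continuous_monomial p : continuous (fun r : R => r ^+ p / p`!%:R).
Proof. by move=> x; apply: cvgM; [exact: exprn_continuous|exact: cvg_cst]. Qed.

Lemma Rintegral_monomial p (b : R) : 0 < b ->
  \int[mu]_(r in `[0, b]) (r ^+ p / p`!%:R) = b ^+ p.+1 / p.+1`!%:R.
Proof.
move=> b0.
rewrite (Rintegral_FTC b0 (is_derive_monomial p) (continuous_monomial (p := p))).
by rewrite expr0n /= mul0r subr0.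
Qed.

(** * Differentiation, continuity and integration of matrix functions *)

Definition mxderive m n (F : R -> 'M[R[i]]_(m, n)) (x : R) (F' : 'M[R[i]]_(m, n)) :=
  forall i j, is_derive x 1 (fun y => Re (F y i j)) (Re (F' i j)) /\
              is_derive x 1 (fun y => Im (F y i j)) (Im (F' i j)).

Definition mxcont m n (F : R -> 'M[R[i]]_(m, n)) :=
  forall i j, continuous (fun y => Re (F y i j)) /\
              continuous (fun y => Im (F y i j)).

Lemma mxderive_cont m n (F : R -> 'M[R[i]]_(m, n)) F' :
  (forall x, mxderive F x (F' x)) -> mxcont F.
Proof.
move=> dF i j; split.
  by apply: is_derive_continuous => x; have [d1 _] := dF x i j; exact: d1.
by apply: is_derive_continuous => x; have [_ d2] := dF x i j; exact: d2.
Qed.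

Lemma mxderive_mxser m n (B : nat -> 'M[R[i]]_(m, n)) x : mxbnd B ->
  mxderive (mxser B) x (mxser (fun k => B k.+1) x).
Proof.
move=> Bb i j; have [b1 b2] := Bb i j; rewrite mxE; split.
  by under eq_fun do rewrite mxE; exact: is_derive_expser.
by under eq_fun do rewrite mxE; exact: is_derive_expser.
Qed.

Lemma mxcont_mxser m n (B : nat -> 'M[R[i]]_(m, n)) :
  mxbnd B -> mxcont (mxser B).
Proof.
move=> Bb; apply: (mxderive_cont (F' := mxser (fun k => B k.+1))) => x.
exact: mxderive_mxser.
Qed.

Lemma mxderive_flip m n (F : R -> 'M[R[i]]_(m, n)) (t x : R) F' :
  mxderive F (t - x) F' -> mxderive (fun y => F (t - y)) x (- F').
Proof.
have d : is_derive x 1 (fun y : R => t - y) (-1).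
  have := is_derive_subfun (is_derive_cst t x 1) (is_derive_id x (1 : R)).
  by rewrite sub0r.
move=> dF i j; have [d1 d2] := dF i j; rewrite mxE; split.
  have := @is_derive1_comp R _ (fun y : R => t - y) x _ _ d1 d.
  by rewrite mulrN1; case: (F' i j).
have := @is_derive1_comp R _ (fun y : R => t - y) x _ _ d2 d.
by rewrite mulrN1; case: (F' i j).
Qed.

Lemma mxderiveM l m n (F : R -> 'M[R[i]]_(l, m)) (G : R -> 'M[R[i]]_(m, n))
    x F' G' : mxderive F x F' -> mxderive G x G' ->
  mxderive (fun y => F y *m G y) x (F' *m G x + F x *m G').
Proof.
move=> dF dG i j; split.
  under eq_fun do rewrite mxE Re_sum.
  apply: is_derive_eq.
    apply: is_derive_sumfun => k; under eq_fun do rewrite ReM.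
    have [a1 a2] := dF i k; have [b1 b2] := dG k j.
    by apply: is_derive_subfun; apply: is_derive_mulfun.
  rewrite !mxE ReD !Re_sum -big_split; apply: eq_bigr => k _ /=.
  by rewrite !ReM /GRing.scale /=; ring.
under eq_fun do rewrite mxE Im_sum.
apply: is_derive_eq.
  apply: is_derive_sumfun => k; under eq_fun do rewrite ImM.
  have [a1 a2] := dF i k; have [b1 b2] := dG k j.
  by apply: is_derive_addfun; apply: is_derive_mulfun.
rewrite !mxE ImD !Im_sum -big_split; apply: eq_bigr => k _ /=.
by rewrite !ImM /GRing.scale /=; ring.
Qed.

Lemma continuous_normc (f : R -> R[i]) :
  continuous (Re \o f) -> continuous (Im \o f) ->
  continuous (fun x => Normc.normc (f x)).
Proof.
move=> cR cI x; rewrite /continuous_at.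
under eq_fun do
  rewrite -[Normc.normc _]ger0_norm ?normc_ge0// -sqrtr_sqr normc_sqr !expr2.
rewrite -[Normc.normc (f x)]ger0_norm ?normc_ge0// -sqrtr_sqr normc_sqr !expr2.
apply: (@cvg_comp _ _ _ _ Num.sqrt _ _ _ _ (@sqrt_continuous R _)).
by apply: cvgD; apply: cvgM; (exact: cR || exact: cI).
Qed.

Lemma continuous_specnorm m n (F : R -> 'M[R[i]]_(m, n)) :
  mxcont F -> continuous (fun x => specnorm (F x)).
Proof.
move=> cF x; apply/cvgrPdist_le => e e0.
have : (fun y => \sum_i \sum_j Normc.normc ((F x - F y) i j)) @ x --> (0 : R).
  rewrite [X in _ --> X](_ : _ = \sum_(i < m) \sum_(j < n) Normc.normc ((F x - F x) i j)).
    apply: cvg_big; first exact: add_continuous.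
    move=> i _; apply: cvg_big; first exact: add_continuous.
    move=> j _; apply: (@continuous_normc (fun y => (F x - F y) i j)) => y.
      rewrite (_ : _ \o _ = fun y => Re (F x i j) - Re (F y i j)); last first.
        by apply/funext => z /=; rewrite !mxE; case: (F x i j); case: (F z i j).
      by apply: cvgB; [exact: cvg_cst|exact: (cF i j).1].
    rewrite (_ : _ \o _ = fun y => Im (F x i j) - Im (F y i j)); last first.
      by apply/funext => z /=; rewrite !mxE; case: (F x i j); case: (F z i j).
    by apply: cvgB; [exact: cvg_cst|exact: (cF i j).2].
  by rewrite subrr big1// => i _; rewrite big1// => j _; rewrite mxE Normc.normc0.
move=> /cvgrPdist_le /(_ _ e0); apply: filterS => y.
rewrite sub0r normrN => H; rewrite (le_trans (specnorm_dist _ _))//.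
exact: le_trans (ler_norm _) H.
Qed.

(** By the extreme value theorem the set of maxima in [max_on] is nonempty, so [xget] returns an
    actual maximum and not its default value 0. *)
Lemma max_onP (f : R -> R) (a b s : R) : a <= b -> continuous f ->
  s \in `[a, b] -> f s <= max_on `[a, b] f.
Proof.
move=> ab cf sab.
have [c cab cmax] := EVT_max ab (continuous_subspaceT cf).
rewrite /max_on.
have [_ +] : [set y | (f @` `[a, b]) y /\ ubound (f @` `[a, b]) y]
   (xget 0 [set y | (f @` `[a, b]) y /\ ubound (f @` `[a, b]) y]).
  apply: xgetPex; exists (f c); split; first by exists c.
  by move=> _ [y yab <-]; exact: cmax.
by apply; exists s.
Qed.

Lemma cintegral_FTC (F f : R -> R[i]) (a b : R) : a < b ->
  (forall x : R, is_derive x 1 (Re \o F) (Re (f x))) ->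
  (forall x : R, is_derive x 1 (Im \o F) (Im (f x))) ->
  continuous (Re \o f) -> continuous (Im \o f) ->
  cintegral a b f = F b - F a.
Proof.
move=> ab dR dI cR cI; rewrite /cintegral (Rintegral_FTC ab dR cR).
by rewrite (Rintegral_FTC ab dI cI) /=; case: (F b); case: (F a).
Qed.

Lemma vintegral_FTC n (F f : R -> 'cV[R[i]]_n) (a b : R) : a < b ->
  (forall x, mxderive F x (f x)) -> mxcont f -> vintegral a b f = F b - F a.
Proof.
move=> ab dF cf; apply/matrixP => i j; rewrite !ord1 !mxE.
have [c1 c2] := cf i 0.
by apply: (cintegral_FTC (F := fun s => F s i 0)) => // x; have [] := dF x i 0.
Qed.

Lemma cintegralD (f g : R -> R[i]) (a b : R) :
  continuous (Re \o f) -> continuous (Im \o f) ->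
  continuous (Re \o g) -> continuous (Im \o g) ->
  cintegral a b (fun s => f s + g s) = cintegral a b f + cintegral a b g.
Proof.
move=> f1 f2 g1 g2; apply: complex_eqP; rewrite ?ReD ?ImD /= -RintegralD//;
  try exact: continuous_integrable.
by apply: eq_Rintegral => s _; rewrite ReD.
by apply: eq_Rintegral => s _; rewrite ImD.
Qed.

Lemma cintegralZ (c : R) (f : R -> R[i]) (a b : R) :
  continuous (Re \o f) -> continuous (Im \o f) ->
  cintegral a b (fun s => c%:C * f s) = c%:C * cintegral a b f.
Proof.
move=> f1 f2; apply: complex_eqP; rewrite ?ReZ ?ImZ /= -RintegralZl//;
  try exact: continuous_integrable.
by apply: eq_Rintegral => s _; rewrite ReZ.
by apply: eq_Rintegral => s _; rewrite ImZ.
Qed.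

Lemma vintegralD n (f g : R -> 'cV[R[i]]_n) (a b : R) :
  mxcont f -> mxcont g ->
  vintegral a b (fun s => f s + g s) = vintegral a b f + vintegral a b g.
Proof.
move=> cf cg; apply/matrixP => i j; rewrite !mxE.
have [f1 f2] := cf i 0; have [g1 g2] := cg i 0.
by rewrite -cintegralD//; congr cintegral; apply/funext => s; rewrite mxE.
Qed.

Lemma vintegralZ n (c : R) (f : R -> 'cV[R[i]]_n) (a b : R) : mxcont f ->
  vintegral a b (fun s => c%:C *: f s) = c%:C *: vintegral a b f.
Proof.
move=> cf; apply/matrixP => i j; rewrite !mxE; have [f1 f2] := cf i 0.
by rewrite -cintegralZ//; congr cintegral; apply/funext => s; rewrite mxE.
Qed.

(** A mean value inequality obtained from scalar integrals only. With z = F(b) - F(a), the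
    fundamental theorem for s |-> [redot z (F s)] gives ||z||^2 as the integral of [redot z (F' s)],
    which Cauchy-Schwarz bounds by ||z|| times the integral of f; then ||z|| is cancelled. *)
Lemma norm2_increment_le n (F F' : R -> 'cV[R[i]]_n) (f : R -> R) (a b : R) :
  a < b -> (forall x, mxderive F x (F' x)) -> mxcont F' -> continuous f ->
  (forall s, s \in `[a, b] -> norm2 (F' s) <= f s) ->
  norm2 (F b - F a) <= \int[mu]_(s in `[a, b]) f s.
Proof.
move=> ab dF cF' cf Ff; set z := F b - F a.
have int_ge0 : 0 <= \int[mu]_(s in `[a, b]) f s.
  by apply: Rintegral_ge0 => s sab; rewrite (le_trans (norm2_ge0 _) (Ff s sab)).
have := norm2_ge0 z; rewrite le_eqVlt => /predU1P[<-//|z0].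
have dz (x : R) : is_derive x 1 (fun s => redot z (F s)) (redot z (F' x)).
  apply: is_derive_sumfun => i; have [d1 d2] := dF x i 0.
  by apply: is_derive_addfun; apply: is_derive_scalefun.
have cz : continuous (fun s => redot z (F' s)).
  move=> x; apply: cvg_big; first exact: add_continuous.
  move=> i _; have [c1 c2] := cF' i 0.
  by apply: cvgD; (apply: cvgM; [exact: cvg_cst|]); [exact: c1|exact: c2].
have E : \int[mu]_(s in `[a, b]) redot z (F' s) = norm2 z ^+ 2.
  rewrite (Rintegral_FTC ab dz cz) norm2_sqr /redot -sumrB.
  by apply: eq_bigr => i _; rewrite !mxE; case: (F b i 0); case: (F a i 0) => * /=; ring.
rewrite -(ler_pM2l z0) -expr2 -E -RintegralZl//; last exact: continuous_integrable.
apply: le_Rintegral => //; first exact: continuous_integrable.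
  by apply: continuous_integrable => x; apply: cvgM; [exact: cvg_cst|exact: cf].
move=> s sab; rewrite (le_trans (redot_le _ _))// ler_wpM2l ?norm2_ge0//.
exact: Ff.
Qed.
End Calculus.

(** * Coefficients and bounds for s^p phi_p(sA) *)

Section Krylov.
Variable R : realType.
Local Notation mu := (@lebesgue_measure R).
Local Notation phi_seq p A := (mxdelay p (fun k => A ^+ k)).

Lemma mxbnd_phi_seq p n (A : 'M[R[i]]_n) : mxbnd (phi_seq p A).
Proof. exact/mxbnd_delay/mxbnd_exp. Qed.

(** Each coefficient is A times the previous one, except that the identity enters at index p, where
    the delayed powers start. For p = 0 the extra term never occurs, as the identity is then the
    initial coefficient. *)
Lemma phi_seqS p n (A : 'M[R[i]]_n) k :
  phi_seq p A k.+1 =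
  A *m phi_seq p A k + (if k.+1 == p then 1%:M else 0).
Proof.
rewrite /mxdelay; case: (ssrnat.ltngtP k.+1 p) => kp.
- by rewrite mulmx0 addr0.
- by rewrite addr0 (subSn (kp : (p <= k)%N)) exprS.
- by rewrite kp subnn expr0 mulmx0 add0r.
Qed.

(** In terms of functions, s^(p+1) phi_(p+1)(sA) has derivative s^p phi_p(sA). *)
Lemma phi_seqSS p n (A : 'M[R[i]]_n) k : phi_seq p.+1 A k.+1 = phi_seq p A k.
Proof. by rewrite /mxdelay ltnS subSS. Qed.

Lemma mxser_exp0 n (A : 'M[R[i]]_n) : mxser (fun k => A ^+ k) 0 = 1%:M.
Proof. by rewrite mxser0 ?expr0//; exact: mxbnd_exp. Qed.

Lemma norm2_phi_le p n (A : 'M[R[i]]_n) (e : 'cV[R[i]]_n) (t K s : R) :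
  norm2 e <= 1 ->
  (forall r, r \in `[0, t] -> specnorm (mxser (fun k => A ^+ k) r) <= K) ->
  s \in `[0, t] ->
  norm2 (mxser (phi_seq p A) s *m e) <= K * (s ^+ p / p`!%:R).
Proof.
move=> e1 HK; elim: p s => [|p IH] s st.
  rewrite expr0 fact0 invr1 !mulr1 (le_trans (norm2_mulmx _ _))//.
  rewrite (_ : mxdelay _ _ = (fun k => A ^+ k)); last first.
    by apply/funext => k; rewrite /mxdelay subn0.
  by rewrite (le_trans _ (HK _ st))// ler_piMr ?specnorm_ge0.
have bnd := mxbnd_phi_seq.
have zero : mxser (phi_seq p.+1 A) 0 = 0 by rewrite mxser0.
have := st; rewrite in_itv /= => /andP[s0 st'].
(* Integration over [0,s] needs 0 < s; at s = 0 both sides vanish because the exponent p+1 is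
   positive. *)
move: s0; rewrite le_eqVlt => /predU1P[s0|s0].
  by rewrite -s0 zero mul0mx norm2_0 expr0n /= mul0r mulr0.
rewrite -Rintegral_monomial// -RintegralZl//; last first.
  exact/continuous_integrable/continuous_monomial.
have dF (x : R) : mxderive (fun r => mxser (phi_seq p.+1 A) r *m e) x
    (mxser (phi_seq p A) x *m e).
  rewrite (_ : phi_seq p A = fun k => phi_seq p.+1 A k.+1); last first.
    by apply/funext => k; rewrite phi_seqSS.
  rewrite -!mxser_mulr; [|exact/mxbndS/bnd].
  rewrite (_ : (fun r => _) = mxser (fun k => phi_seq p.+1 A k *m e)).
    by apply: mxderive_mxser; apply: mxbnd_mulr.
  by apply/funext => r; rewrite mxser_mulr.
rewrite -[mxser _ s *m e]subr0 -[X in _ - X](mul0mx _ e) -[X in _ - X *m _]zero.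
apply: (norm2_increment_le (F := fun r => mxser (phi_seq p.+1 A) r *m e)
  (F' := fun r => mxser (phi_seq p A) r *m e)) => //.
- rewrite (_ : (fun r => _) = mxser (fun k => phi_seq p A k *m e)).
    by apply: mxcont_mxser; apply: mxbnd_mulr.
  by apply/funext => r; rewrite mxser_mulr.
- by move=> x; apply: cvgM; [exact: cvg_cst|exact: continuous_monomial].
move=> r; rewrite in_itv /= => /andP[r0 rs]; apply: IH.
by rewrite in_itv /= r0 (le_trans rs).
Qed.

End Krylov.

(** * The error of the Krylov propagator *)

Theorem theorem1 (R : realType) (n m p : nat) (t : R)
    (A : 'M[R[i]]_n) (v : 'cV[R[i]]_n) (beta : R)
    (V : 'M[R[i]]_(n, m.+1)) (H : 'M[R[i]]_m.+1) (h : R)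
    (w : 'cV[R[i]]_n) (U : 'M[R[i]]_(n, m.+1))
    (t_gt0 : 0 < t)
    (v_neq0 : v != 0)
    (beta_def : beta = norm2 v)
    (H_hessenberg : forall i j : 'I_m.+1, (j.+1 < i)%N -> H i j = 0)
    (H_subdiag : forall i j : 'I_m.+1, i = j.+1 :> nat -> 0 < H i j)
    (h_gt0 : 0 < h)
    (V_e1 : beta%:C *: (V *m unitv R ord0) = v)
    (arnoldi : A *m V =
       V *m H + h%:C *: (w *m (unitv R ord_max)^t*) + U) :
  krylov_error p A v V H t =
    - ((h / t ^+ p)%:C *:
       vintegral 0 t (fun s =>
         krylov_defect p beta H s *: (expmx ((t - s)%:C *: A) *m w)))
    - ((t ^+ p)^-1%:C *:
       vintegral 0 t (fun s =>
         expmx ((t - s)%:C *: A) *m U *m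
           ((s ^+ p)%:C *: krylov_y p beta H s)))
  /\
  (forall eps C1 C2 kappa1 kappa2 : R,
     0 < eps -> 0 <= C1 -> 0 <= C2 ->
     specnorm U <= C1 * eps * specnorm A ->
     `|norm2 w - 1| <= C2 * eps ->
     kappa1 = max_on `[0, t] (fun s => specnorm (expmx (s%:C *: A))) ->
     kappa2 = max_on `[0, t] (fun s => specnorm (expmx (s%:C *: H))) ->
     norm2 (krylov_error p A v V H t) <=
       (1 + C2 * eps) * kappa1 * defect_integral p beta h H t
       + C1 * eps * specnorm A * (beta * kappa1 * kappa2 * t / (p.+1)`!%:R)).
Proof.
pose e1 := unitv R (ord0 : 'I_m.+1).
pose em := (unitv R (ord_max : 'I_m.+1))^t*.
pose DH := mxdelay p (fun k => H ^+ k).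
pose DA := mxdelay p (fun k => A ^+ k).
(* [y] holds the coefficients of s^p y_p(s); [f1], [f2] and [g] are the sequences r_k, u_k and g_k,
   and [E s] is e^(sA). *)
pose y k := beta%:C *: (DH k *m e1).
pose f1 k := w *m (em *m y k).
pose f2 k := U *m y k.
pose g k := DA k *m v - V *m y k.
pose E (s : R) := mxser (fun k => A ^+ k) s.
have bDH : mxbnd DH by exact: mxbnd_phi_seq.
have bDA : mxbnd DA by exact: mxbnd_phi_seq.
have bE : mxbnd (fun k => A ^+ k) by exact: mxbnd_exp.
have by_ : mxbnd y by apply: mxbndZ; exact: mxbnd_mulr.
have bf1 : mxbnd f1 by apply: mxbnd_mull; exact: mxbnd_mull.
have bf2 : mxbnd f2 by exact: mxbnd_mull.
have bg : mxbnd g.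
  rewrite (_ : g = fun k => DA k *m v + (- V) *m y k); last first.
    by apply/funext => k; rewrite mulNmx.
  by apply: mxbndD; [exact: mxbnd_mulr|exact: mxbnd_mull].
have gE s : mxser g s = mxser DA s *m v - V *m mxser y s.
  rewrite (_ : g = fun k => DA k *m v + (- V) *m y k); last first.
    by apply/funext => k; rewrite mulNmx.
  rewrite mxserD; [|exact: mxbnd_mulr|exact: mxbnd_mull].
  by rewrite mxser_mulr// mxser_mull// mulNmx.
have yE s : mxser y s = (s ^+ p)%:C *: krylov_y p beta H s.
  rewrite /krylov_y mxserZ; last exact: mxbnd_mulr.
  by rewrite mxser_mulr// -phimxE scalerA mulrC -scalerA -!scalemxAl.
(* The defect already contains the factor s^p, so it is exactly the last entry of s^p y_p(s). *)
have defectE s : krylov_defect p beta H s = mxser (fun k => em *m y k) s 0 0.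
  rewrite mxser_mull// mxserZ; last exact: mxbnd_mulr.
  by rewrite mxser_mulr// -phimxE -scalemxAr mxE /krylov_defect mulmxA.
have f1E s : mxser f1 s = krylov_defect p beta H s *: w.
  rewrite mxser_mull; last exact: mxbnd_mull.
  rewrite mxser_mull// [em *m _]mx11_scalar mul_mx_scalar; congr (_ *: _).
  by rewrite defectE mxser_mull.
have f2E s : mxser f2 s = U *m ((s ^+ p)%:C *: krylov_y p beta H s).
  by rewrite mxser_mull// yE.
have gerr : mxser g t = - ((t ^+ p)%:C *: krylov_error p A v V H t).
  rewrite gE yE -phimxE /krylov_error /krylov_y -beta_def.
  by rewrite -scalemxAl -!scalemxAr -scalerBr -[RHS]scalerN opprB mulmxA.
(* For p > 0 both delayed sequences start with 0; for p = 0 the claim is the normalisation beta V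
   e_1 = v. *)
have g0 : g 0%N = 0.
  rewrite /g /y /DA /DH /mxdelay; case: ifP => _.
    by rewrite !mul0mx scaler0 mulmx0 subr0.
  by rewrite !sub0n !expr0 !mul1mx -scalemxAr V_e1 subrr.
(* At k+1 = p the recurrence for A contributes v and the one for H contributes beta V e_1 = v, so
   these terms cancel. What remains is (A V - V H) y_k, which the Arnoldi relation evaluates. *)
have gS k : g k.+1 = A *m g k + (h%:C *: f1 k + f2 k).
  rewrite /g mulmxBr [A *m (V *m _)]mulmxA arnoldi.
  rewrite /DA phi_seqS -/DA mulmxDl mulmxA.
  have -> : V *m y k.+1 = V *m H *m y k + (if k.+1 == p then v else 0).
    rewrite /y /DH phi_seqS -/DH mulmxDl scalerDr mulmxDr.
    rewrite -[H *m _ *m _]mulmxA scalemxAr mulmxA; congr (_ + _).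
    by case: ifP => _; rewrite ?mul1mx ?mul0mx ?scaler0 ?mulmx0// -scalemxAr.
  rewrite !mulmxDl -scalemxAl -[w *m _ *m _]mulmxA -/(f1 k) -/(f2 k).
  have -> : (if k.+1 == p then 1%:M else 0) *m v = (if k.+1 == p then v else 0).
    by case: ifP; rewrite ?mul1mx ?mul0mx.
  set a := A *m DA k *m v; set b := (if _ then _ else _).
  set c := V *m H *m _.
  rewrite -(addrA c); move: a b c (_ *: f1 k + f2 k) => a b c q.
  by rewrite (opprD c q) addrA subrK opprD addrACA subrr addr0.
have bAg : mxbnd (fun k => A *m g k) by exact: mxbnd_mull.
have bhf1 : mxbnd (fun k => h%:C *: f1 k) by exact: mxbndZ.
have bhf12 : mxbnd (fun k => h%:C *: f1 k + f2 k) by exact: mxbndD.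
have dF (s : R) : mxderive (fun s => E (t - s) *m mxser g s) s
    (h%:C *: (E (t - s) *m mxser f1 s) + E (t - s) *m mxser f2 s).
  (* A is split off on the right, next to G(s), so that the terms -E A G and E A G of the product
     rule cancel. *)
  have ES x : mxser (fun k => A ^+ k.+1) x = E x *m A.
    by rewrite -mxser_mulr//; congr mxser; apply/funext => k; rewrite exprSr.
  have gS' : mxser (fun k => g k.+1) s =
      A *m mxser g s + (h%:C *: mxser f1 s + mxser f2 s).
    rewrite (_ : (fun k => _) = fun k => A *m g k + (h%:C *: f1 k + f2 k)).
      by rewrite (mxserD s bAg bhf12) (mxserD s bhf1 bf2) (mxserZ _ s bf1)
        (mxser_mull _ s bg).
    by apply/funext => k; rewrite gS.
  have d1 : mxderive (fun r => E (t - r)) s (- (E (t - s) *m A)).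
    by rewrite -ES; apply: mxderive_flip; exact: (mxderive_mxser (t - s) bE).
  have d2 : mxderive (mxser g) s
      (A *m mxser g s + (h%:C *: mxser f1 s + mxser f2 s)).
    by rewrite -gS'; exact: mxderive_mxser.
  have := mxderiveM d1 d2.
  by rewrite mulNmx mulmxDr mulmxA addKr mulmxDr -scalemxAr.
pose F1 s := E (t - s) *m mxser f1 s.
pose F2 s := E (t - s) *m mxser f2 s.
have cEf f : mxbnd f -> mxcont (fun s => E (t - s) *m mxser f s).
  move=> bf; apply: (mxderive_cont (F' := fun s =>
    - mxser (fun k => A ^+ k.+1) (t - s) *m mxser f s +
    E (t - s) *m mxser (fun k => f k.+1) s)) => x.
  apply: mxderiveM; last exact: mxderive_mxser.
  by apply: mxderive_flip; exact: mxderive_mxser.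
have cF1 : mxcont F1 by exact: cEf.
have cF2 : mxcont F2 by exact: cEf.
have chF1 : mxcont (fun s => h%:C *: F1 s).
  rewrite (_ : (fun s => _) = fun s => E (t - s) *m mxser (fun k => h%:C *: f1 k) s).
    exact: cEf.
  by apply/funext => s; rewrite (mxserZ _ s bf1) scalemxAr.
have cF12 : mxcont (fun s => h%:C *: F1 s + F2 s).
  rewrite (_ : (fun s => _) =
      fun s => E (t - s) *m mxser (fun k => h%:C *: f1 k + f2 k) s).
    exact: cEf.
  apply/funext => s; rewrite (mxserD s bhf1 bf2) (mxserZ _ s bf1).
  by rewrite mulmxDr scalemxAr.
(* At the upper end the exponential is the identity, and at the lower end G(0) = 0. *)
have Fg : E (t - t) *m mxser g t - E (t - 0) *m mxser g 0 =
    - ((t ^+ p)%:C *: krylov_error p A v V H t).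
  by rewrite subrr [E 0]mxser_exp0 mul1mx [mxser g 0]mxser0// g0 mulmx0 subr0 gerr.
have tp0 : (t ^+ p)%:C != 0 :> R[i].
  by rewrite fmorph_eq0 expf_neq0// gt_eqF.
have F1E : F1 = fun s =>
    krylov_defect p beta H s *: (expmx ((t - s)%:C *: A) *m w).
  by apply/funext => s; rewrite /F1 f1E -scalemxAr expmxE.
have F2E : F2 = fun s =>
    expmx ((t - s)%:C *: A) *m U *m ((s ^+ p)%:C *: krylov_y p beta H s).
  by apply/funext => s; rewrite /F2 f2E mulmxA expmxE.
split.
  (* Part (a): the integral of h F1 + F2 equals -t^p l_p(t), and t^p is cancelled. *)
  rewrite -F1E -F2E; have := vintegral_FTC t_gt0 dF cF12.
  rewrite Fg (vintegralD 0 t chF1 cF2) (vintegralZ h 0 t cF1).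
  move: (vintegral 0 t F1) (vintegral 0 t F2) => I1 I2 I12.
  apply: (scalerI tp0); rewrite -[LHS]opprK -I12 opprD scalerBr !scalerN !scalerA.
  by rewrite -!rmorphM /= mulrC divfK ?mulfV ?scale1r// expf_neq0// gt_eqF.
move=> eps C1 C2 kappa1 kappa2 eps0 C10 C20 Ule wle k1E k2E.
have k1le s : s \in `[0, t] -> specnorm (E s) <= kappa1.
  move=> st; rewrite k1E; under [X in max_on _ X]eq_fun do rewrite expmxE.
  apply: (max_onP (f := fun s => specnorm (E s))) => //; first exact: ltW.
  exact/continuous_specnorm/mxcont_mxser.
have k2le s : s \in `[0, t] -> specnorm (mxser (fun k => H ^+ k) s) <= kappa2.
  move=> st; rewrite k2E; under [X in max_on _ X]eq_fun do rewrite expmxE.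
  apply: (max_onP (f := fun s => specnorm (mxser (fun k => H ^+ k) s))) => //.
    exact: ltW.
  exact/continuous_specnorm/mxcont_mxser/mxbnd_exp.
have k10 : 0 <= kappa1.
  by rewrite (le_trans (specnorm_ge0 (E 0)))// k1le// in_itv /= lexx ltW.
have b0 : 0 <= beta by rewrite beta_def norm2_ge0.
pose d s := Normc.normc (krylov_defect p beta H s).
have d0 s : 0 <= d s by exact: normc_ge0.
have w1 : norm2 w <= 1 + C2 * eps.
  by rewrite addrC -lerBlDr (le_trans (ler_norm _)).
(* Part (b): [a1] and [a2] collect the constants in ||h F1(s)|| <= a1 |delta(s)| and ||F2(s)|| <= a2
   s^p/p!. Here kappa_1 applies to e^((t-s)A) since t - s stays in [0,t], and kappa_2 comes from
   [norm2_phi_le] with the unit vector e_1. *)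
pose a1 := h * ((1 + C2 * eps) * kappa1).
pose a2 := C1 * eps * specnorm A * (beta * kappa1 * kappa2).
have tsI s : s \in `[0, t] -> t - s \in `[0, t].
  by rewrite !in_itv /= => /andP[s0 st]; rewrite subr_ge0 st gerBl.
have F1le s : s \in `[0, t] -> norm2 (h%:C *: F1 s) <= a1 * d s.
  move=> st; rewrite norm2Z normc_real gtr0_norm// /a1.
  have -> : h * ((1 + C2 * eps) * kappa1) * d s =
    h * (kappa1 * (d s * (1 + C2 * eps))) by ring.
  rewrite ler_pM2l// /F1 f1E (le_trans (norm2_mulmx _ _))//.
  apply: ler_pM; [exact: specnorm_ge0|exact: norm2_ge0|exact: k1le (tsI _ st)|].
  by rewrite norm2Z; apply: ler_wpM2l; [exact: d0|exact: w1].
have F2le s : s \in `[0, t] -> norm2 (F2 s) <= a2 * (s ^+ p / p`!%:R).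
  move=> st.
  have yle : norm2 (mxser y s) <= beta * (kappa2 * (s ^+ p / p`!%:R)).
    rewrite mxserZ; last exact: mxbnd_mulr.
    rewrite mxser_mulr// norm2Z normc_real ger0_norm// ler_wpM2l//.
    by apply: (@norm2_phi_le R p m.+1 H e1 t) => //; rewrite norm2_unitv.
  have -> : a2 * (s ^+ p / p`!%:R) = kappa1 *
      (C1 * eps * specnorm A * (beta * (kappa2 * (s ^+ p / p`!%:R)))).
    by rewrite /a2; ring.
  rewrite /F2 (le_trans (norm2_mulmx _ _))//.
  apply: ler_pM; [exact: specnorm_ge0|exact: norm2_ge0|exact: k1le (tsI _ st)|].
  rewrite mxser_mull// (le_trans (norm2_mulmx _ _))//.
  by apply: ler_pM => //; [exact: specnorm_ge0|exact: norm2_ge0].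
have cd : continuous d.
  have cy : mxcont (mxser (fun k => em *m y k)).
    by apply: mxcont_mxser; exact: mxbnd_mull.
  rewrite /d; under eq_fun do rewrite defectE.
  by apply: continuous_normc; [exact: (cy 0 0).1|exact: (cy 0 0).2].
have ca1 : continuous (fun s => a1 * d s).
  by move=> x; apply: cvgM; [exact: cvg_cst|exact: cd].
have ca2 : continuous (fun s : R => a2 * (s ^+ p / p`!%:R)).
  by move=> x; apply: cvgM; [exact: cvg_cst|exact: continuous_monomial].
have ca x : {for x, continuous (fun s => a1 * d s + a2 * (s ^+ p / p`!%:R))}.
  by apply: cvgD; [exact: ca1|exact: ca2].
have tp : 0 < t ^+ p by rewrite exprn_gt0.
have := norm2_increment_le t_gt0 dF cF12 ca.
rewrite Fg norm2N norm2Z normc_real gtr0_norm// => /(_ _)/le_trans incr.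
rewrite -(ler_pM2l tp); apply: incr.
  move=> s st; rewrite (le_trans (norm2D _ _))// lerD//; first exact: F1le.
  exact: F2le.
rewrite RintegralD//; try exact: continuous_integrable.
rewrite !RintegralZl//; try exact: continuous_integrable.
  (* The integral of s^p/p! is t^(p+1)/(p+1)!; since the inequality was multiplied by t^p, this
     leaves the t/(p+1)! of the claim, and both sides are equal. *)
  rewrite Rintegral_monomial// /defect_integral /a1 /a2 exprS le_eqVlt.
  apply/orP; left; apply/eqP; field.
  by rewrite expf_neq0 ?gt_eqF// ltr0n fact_gt0.
exact/continuous_integrable/continuous_monomial.
Qed.
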